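(* Let $f:M\to\mathbb{R}^3$ be an isothermic surface which is not contained in a sphere, with dual surface $f^d$. Let $\varrho\in\mathbb{C}\setminus\{0\}$ and let $\hat f=D_{\phi,\varrho}(f)=f+T$ be a $\varrho$-Darboux transform given by a $d_\varrho$-parallel section $\phi=\begin{pmatrix}\alpha\\ \beta\end{pmatrix}$, that is, $T=\alpha\beta^{-1}$. Then $\hat f$ is a classical Darboux transform of $f$ if and only if $\varrho\in\mathbb{R}\setminus\{0\}$.
   Context: $\mathbb{H}=\mathrm{span}_{\mathbb{R}}\{1,i,j,k\}=\mathbb{R}^4$, $\mathbb{R}^3=\mathrm{Im}\,\mathbb{H}$, $\mathbb{C}=\mathrm{span}_{\mathbb{R}}\{1,i\}\subset\mathbb{H}$. $M$ is a Riemann surface with universal cover $\tilde M$. A conformal immersion $f$ is isothermic if there is a branched conformal immersion $f^d:\tilde M\to\mathbb{R}^4$ (dual surface) with $df\wedge df^d=df^d\wedge df=0$. For a surface which is not part of a round sphere the dual surface is unique up to homothety and translation. For $\varrho\in\mathbb{C}$, $\phi=\begin{pmatrix}\alpha\\ \beta\end{pmatrix}:\tilde M\to\mathbb{H}^2$ is $d_\varrho$-parallel iff $d\alpha=-df\,\beta$ and $d\beta=-df^d\,\alpha\varrho$. If moreover $T=\alpha\beta^{-1}:\tilde M\to\mathbb{R}^4\setminus\{0\}$, then $D_{\phi,\varrho}(f)=f+T$ is called a $\varrho$-Darboux transform of $f$ ($\varrho\neq0$). Classical Darboux transform of $f$: a surface $f+T$ where $T:\tilde M\to\mathbb{R}^4\setminus\{0\}$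 satisfies $dT=-df+T\,df^d\,r\,T$ for some $r\in\mathbb{R}\setminus\{0\}$. *)

(* Defs.v *)
From HB Require Import structures.
From mathcomp Require Import all_boot all_order all_algebra.
From mathcomp Require Import ring lra.
From mathcomp Require Import all_classical all_reals all_analysis.
Set Implicit Arguments.
Unset Strict Implicit.
Unset Printing Implicit Defensive.
Import Order.TTheory GRing.Theory Num.Theory.
Import numFieldNormedType.Exports.
Local Open Scope classical_set_scope.
Local Open Scope ring_scope.

(* The entries of a row are the coordinates in the basis 1, i, j, k. *)
Definition quat (R : realType) : Type := 'rV[R]_4.

HB.instance Definition _ (R : realType) := NormedModule.on (quat R).

Section Quaternions.
Context {R : realType}.
Implicit Types p q : quat R.

Definition mkq (a b c d : R) : quat R :=
  \row_(i < 4) nth 0 [:: a; b; c; d] i.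

Definition qre q : R := q 0 (inord 0).
Definition qi q : R := q 0 (inord 1).
Definition qj q : R := q 0 (inord 2).
Definition qk q : R := q 0 (inord 3).

Definition qone : quat R := mkq 1 0 0 0.
Definition imag_i : quat R := mkq 0 1 0 0.

Definition qmul p q : quat R :=
  mkq (qre p * qre q - qi p * qi q - qj p * qj q - qk p * qk q)
      (qre p * qi q + qi p * qre q + qj p * qk q - qk p * qj q)
      (qre p * qj q - qi p * qk q + qj p * qre q + qk p * qi q)
      (qre p * qk q + qi p * qj q - qj p * qi q + qk p * qre q).

(* Euclidean inner product of R^4; the norm of the normed module [quat R] is
   the equivalent sup norm and is only used for its topology. *)
Definition qdot p q : R :=
  qre p * qre q + qi p * qi q + qj p * qj q + qk p * qk q.

Definition qconj p : quat R := mkq (qre p) (- qi p) (- qj p) (- qk p).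

Definition qinv p : quat R := (qdot p p)^-1 *: qconj p.

Lemma mkqE a b c d :
  (qre (mkq a b c d) = a) * (qi (mkq a b c d) = b) *
  (qj (mkq a b c d) = c) * (qk (mkq a b c d) = d).
Proof. by rewrite /qre /qi /qj /qk !mxE !inordK. Qed.

Lemma quatP p q :
  qre p = qre q -> qi p = qi q -> qj p = qj q -> qk p = qk q -> p = q.
Proof.
move=> h0 h1 h2 h3; apply/rowP => i; rewrite -[i]inord_val.
by case: i => [[|[|[|[|//]]]] ?] /=.
Qed.

Lemma quatDE p q :
  (qre (p + q) = qre p + qre q) * (qi (p + q) = qi p + qi q) *
  (qj (p + q) = qj p + qj q) * (qk (p + q) = qk p + qk q).
Proof. by rewrite /qre /qi /qj /qk !mxE. Qed.

Lemma quatZE (a : R) p :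
  (qre (a *: p) = a * qre p) * (qi (a *: p) = a * qi p) *
  (qj (a *: p) = a * qj p) * (qk (a *: p) = a * qk p).
Proof. by rewrite /qre /qi /qj /qk !mxE. Qed.

Lemma quat0E : (qre 0 = 0) * (qi 0 = 0) * (qj 0 = 0) * (qk 0 = 0).
Proof. by rewrite /qre /qi /qj /qk !mxE. Qed.

Fact qmulA : associative qmul.
Proof. by move=> p q r; apply: quatP; rewrite !mkqE; ring. Qed.

Fact qmul1l : left_id qone qmul.
Proof. by move=> p; apply: quatP; rewrite !mkqE; ring. Qed.

Fact qmul1r : right_id qone qmul.
Proof. by move=> p; apply: quatP; rewrite !mkqE; ring. Qed.

Fact qmulDl : left_distributive qmul +%R.
Proof.
by move=> p q r; apply: quatP; rewrite ?(mkqE, quatDE); ring.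
Qed.

Fact qmulDr : right_distributive qmul +%R.
Proof.
by move=> p q r; apply: quatP; rewrite ?(mkqE, quatDE); ring.
Qed.

Fact qone_neq0 : qone != 0.
Proof.
apply/eqP => /(congr1 qre); rewrite mkqE quat0E => /eqP.
by rewrite oner_eq0.
Qed.

Lemma qdot_eq0 p : (qdot p p == 0) = (p == 0).
Proof.
apply/idP/eqP => [|->]; last by rewrite /qdot !quat0E !mulr0 !addr0.
rewrite /qdot -!expr2 !paddr_eq0 ?addr_ge0 ?sqr_ge0//.
rewrite !sqrf_eq0 => /andP[/andP[/andP[/eqP h0 /eqP h1] /eqP h2] /eqP h3].
by apply: quatP; rewrite quat0E.
Qed.

End Quaternions.

HB.instance Definition _ (R : realType) :=
  GRing.Zmodule_isNzRing.Build (quat R)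
    (@qmulA R) (@qmul1l R) (@qmul1r R) (@qmulDl R) (@qmulDr R) (@qone_neq0 R).

Section QuaternionAlgebra.
Context {R : realType}.
Implicit Types p q : quat R.

Fact quat_scalerAl (a : R) p q : a *: (p * q) = (a *: p) * q.
Proof. by apply: quatP; rewrite ?(mkqE, quatZE); ring. Qed.

HB.instance Definition _ := GRing.Lmodule_isLalgebra.Build R (quat R)
  quat_scalerAl.

Fact quat_scalerAr (a : R) p q : a *: (p * q) = p * (a *: q).
Proof. by apply: quatP; rewrite ?(mkqE, quatZE); ring. Qed.

HB.instance Definition _ := GRing.Lalgebra_isAlgebra.Build R (quat R)
  quat_scalerAr.

Definition qunit : pred (quat R) := [pred q | q != 0].

Definition qinv_total q : quat R := if qunit q then qinv q else q.

Fact quat_mulVr : {in qunit, left_inverse 1 qinv_total *%R}.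
Proof.
move=> p p0; rewrite /qinv_total ifT//.
have d0 : qdot p p != 0 by rewrite qdot_eq0.
move: d0; rewrite /qdot => d0.
by apply: quatP; rewrite ?(mkqE, quatZE) /qdot; field.
Qed.

Fact quat_mulrV : {in qunit, right_inverse 1 qinv_total *%R}.
Proof.
move=> p p0; rewrite /qinv_total ifT//.
have d0 : qdot p p != 0 by rewrite qdot_eq0.
move: d0; rewrite /qdot => d0.
by apply: quatP; rewrite ?(mkqE, quatZE) /qdot; field.
Qed.

Fact quat_unitP p q : q * p = 1 /\ p * q = 1 -> qunit p.
Proof.
move=> [h _]; apply/eqP => p0; move: h; rewrite p0 mulr0 => /esym/eqP.
by rewrite oner_eq0.
Qed.

Fact quat_invr_out : {in [predC qunit], qinv_total =1 id}.
Proof. by move=> p /negbTE hp; rewrite /qinv_total; have -> : qunit p = false. Qed.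

HB.instance Definition _ := GRing.NzRing_hasMulInverse.Build (quat R)
  quat_mulVr quat_mulrV quat_unitP quat_invr_out.

Definition complex_line : set (quat R) :=
  [set q | exists a b : R, q = a *: 1 + b *: imag_i].

Definition im_quat : set (quat R) := [set q | qre q = 0].

End QuaternionAlgebra.

Notation plane R := (R * R)%type.

Section Plane.
Context {R : realType}.

Fixpoint Ck {V : normedModType R} (n : nat) (U : set (plane R))
    (g : plane R -> V) : Prop :=
  match n with
  | 0%N => forall z, U z -> {for z, continuous g}
  | m.+1 => (forall z, U z -> differentiable g z) /\
            (forall v : plane R, Ck m U (fun z => 'd g z v))
  end.

Definition mult_i (v : plane R) : plane R := (- v.2, v.1).

Definition holomorphic_at (g : plane R -> plane R) (z : plane R) : Prop :=
  differentiable g z /\ forall v, 'd g z (mult_i v) = mult_i ('d g z v).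

End Plane.

(* [param] is only meaningful on [cimage], where it is inverse to [coord]. *)
Record chart (R : realType) (M : topologicalType) := Chart {
  dom : set M;
  coord : M -> plane R;
  param : plane R -> M }.

Section Charts.
Context {R : realType}.

Definition cimage {M : topologicalType} (c : chart R M) : set (plane R) :=
  coord c @` dom c.

Definition is_chart {M : topologicalType} (c : chart R M) : Prop :=
  [/\ open (dom c), open (cimage c),
      forall x, dom c x -> param c (coord c x) = x,
      {within dom c, continuous (coord c)} &
      {within cimage c, continuous (param c)}].

Definition holomorphic_in_charts {M N : topologicalType} (F : M -> N)
    (c : chart R M) (c' : chart R N) : Prop :=
  forall x, dom c x -> dom c' (F x) ->
    holomorphic_at (coord c' \o F \o param c) (coord c x).

End Charts.

(* Second countability is not required: it follows by Rado's theorem. *)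
Record riemannSurface (R : realType) := RiemannSurface {
  surface_space :> topologicalType;
  atlas : set (chart R surface_space);
  surface_nonempty : [set: surface_space] !=set0;
  surface_connected : connected [set: surface_space];
  surface_hausdorff : hausdorff_space surface_space;
  atlas_chart : forall c, atlas c -> is_chart c;
  atlas_cover : forall x, exists2 c, atlas c & dom c x;
  atlas_holomorphic : forall c c', atlas c -> atlas c' ->
    holomorphic_in_charts id c c' }.

Arguments atlas {R} _.

Section Maps.
Context {R : realType}.

Definition holomorphic {M N : riemannSurface R} (F : M -> N) : Prop :=
  continuous F /\
  forall c c', atlas M c -> atlas N c' -> holomorphic_in_charts F c c'.

Definition smooth {V : normedModType R} {M : riemannSurface R} (g : M -> V) :
    Prop :=
  forall c, atlas M c -> forall n, Ck n (cimage c) (g \o param c).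

(* The 1-form dg, expressed in the chart c at the point with coordinate z and
   evaluated on the tangent vector with coordinates v.  Equations between
   forms are required in all charts of the atlas. *)
Definition dform {V : normedModType R} {M : riemannSurface R} (g : M -> V)
    (c : chart R M) (z v : plane R) : V :=
  'd (g \o param c) z v.

Definition wedge {M : riemannSurface R} (g h : M -> quat R)
    (c : chart R M) (z v w : plane R) : quat R :=
  dform g c z v * dform h c z w - dform g c z w * dform h c z v.

Definition simply_connected (M : topologicalType) : Prop :=
  (forall x y : M, exists g : R -> M,
     [/\ {within `[0, 1], continuous g}, g 0 = x & g 1 = y]) /\
  (forall g : R -> M, {within `[0, 1], continuous g} -> g 0 = g 1 ->
     exists H : R * R -> M,
       [/\ {within `[0, 1]%classic `*` `[0, 1]%classic, continuous H},
           forall s, 0 <= s <= 1 -> H (s, 0) = g s,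
           forall s, 0 <= s <= 1 -> H (s, 1) = g 0 &
           forall t, 0 <= t <= 1 -> H (0, t) = g 0 /\ H (1, t) = g 0]).

Definition evenly_covered {X Y : topologicalType} (pr : X -> Y) (U : set Y) :
    Prop :=
  exists (I : Type) (S : I -> set X),
    [/\ forall i, open (S i),
        trivIset [set: I] S,
        pr @^-1` U = \bigcup_i S i,
        forall i, set_bij (S i) U pr &
        forall i W, W `<=` S i -> open W -> open (pr @` W)].

Definition covering_map {X Y : topologicalType} (pr : X -> Y) : Prop :=
  continuous pr /\
  forall y, exists U, [/\ open U, U y & evenly_covered pr U].

Definition universal_cover {Mt M : riemannSurface R} (pr : Mt -> M) : Prop :=
  [/\ simply_connected Mt, covering_map pr & holomorphic pr].

End Maps.

Section Isothermic.
Context {R : realType}.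

Definition conformal_immersion_at {M : riemannSurface R} (g : M -> quat R)
    (x : M) : Prop :=
  forall c, atlas M c -> dom c x ->
    let gx := dform g c (coord c x) (1, 0) in
    let gy := dform g c (coord c x) (0, 1) in
    [/\ qdot gx gx = qdot gy gy, qdot gx gy = 0 & gx != 0].

Definition conformal_immersion {M : riemannSurface R} (g : M -> quat R) :
    Prop :=
  smooth g /\ forall x, conformal_immersion_at g x.

(* The deleted neighbourhood lets x itself be a branch point. *)
Definition branched_conformal_immersion {M : riemannSurface R}
    (g : M -> quat R) : Prop :=
  smooth g /\ forall x, \forall y \near x^', conformal_immersion_at g y.

Definition in_round_sphere {M : riemannSurface R} (f : M -> quat R) : Prop :=
  exists (m : quat R) (r : R), [/\ im_quat m, 0 < r &
    forall x, qdot (f x - m) (f x - m) = r ^+ 2].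

Context {Mt M : riemannSurface R} (pr : Mt -> M).
Implicit Types (f : M -> quat R) (fd T alpha beta fhat : Mt -> quat R).

(* On the universal cover, f stands for its lift f \o pr. *)
Definition dual_surface f fd : Prop :=
  branched_conformal_immersion fd /\
  forall c, atlas Mt c -> forall z, cimage c z -> forall v w,
    wedge (f \o pr) fd c z v w = 0 /\ wedge fd (f \o pr) c z v w = 0.

Definition isothermic f : Prop :=
  conformal_immersion f /\ exists fd, dual_surface f fd.

Definition parallel_section f fd (rho : quat R) alpha beta : Prop :=
  [/\ smooth alpha, smooth beta &
      forall c, atlas Mt c -> forall z, cimage c z -> forall v,
        dform alpha c z v = - dform (f \o pr) c z v * beta (param c z) /\
        dform beta c z v = - dform fd c z v * alpha (param c z) * rho].

Definition rho_darboux_transform f fd (rho : quat R) alpha beta fhat : Prop :=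
  [/\ parallel_section f fd rho alpha beta,
      forall x, beta x != 0,
      forall x, alpha x / beta x != 0 &
      forall x, fhat x = f (pr x) + alpha x / beta x].

Definition classical_darboux_transform f fd fhat : Prop :=
  exists (T : Mt -> quat R) (r : R),
    [/\ smooth T, r != 0, forall x, T x != 0,
        forall c, atlas Mt c -> forall z, cimage c z -> forall v,
          dform T c z v = - dform (f \o pr) c z v +
            T (param c z) * dform fd c z v * r%:A * T (param c z) &
        forall x, fhat x = f (pr x) + T x].

End Isothermic.

(* Main.v *)
Require Import Defs.
From HB Require Import structures.
From mathcomp Require Import all_boot all_order all_algebra.
From mathcomp Require Import all_classical all_reals all_analysis.
Set Implicit Arguments.
Unset Strict Implicit.
Unset Printing Implicit Defensive.
Import Order.TTheory GRing.Theory Num.Theory.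
Import numFieldNormedType.Exports.
Local Open Scope classical_set_scope.
Local Open Scope ring_scope.

(* Write T = alpha / beta and let beta rho beta^-1 stand for the conjugate of
   rho.  The parallel equations give
     dT = - df + T dfd T (beta rho beta^-1),
   which is the Riccati equation with parameter r as soon as rho = r is real,
   hence central.  Conversely, if the Riccati equation with parameter r holds as
   well, then T dfd T (beta rho beta^-1 - r) = 0.  A branched conformal
   immersion has a point with dfd <> 0, where this forces beta rho beta^-1 = r,
   that is rho = r. *)

(** * Locality of the Fréchet differential *)

Section Differential.
Context {R : realType} {V W : normedModType R}.

(** Since [f x = g x] and the remainder is unchanged near 0, the first-order expansion of [f] at [x]
    is also one of [g]; uniqueness of the differential concludes. *)
Lemma near_eq_is_diff (f g df : V -> W) (x : V) :
  {near x, f =1 g} -> is_diff x f df -> is_diff x g df.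
Proof.
move=> fg [fx dfE].
have fgx : f x = g x by exact: nbhs_singleton fg.
have [dfc dfo] := (diff_locallyP _ _).1 fx.
have gE : g \o shift x = cst (g x) + 'd f x +o_ 0 id.
  apply/eqaddoP => e e0.
  have H := (eqaddoP _ _ _ _).1 dfo e e0.
  have fgs : \forall h \near (0 : V), f (h + x) = g (h + x).
    rewrite (near_shift x) sub0r; apply: filterS fg => y /=.
    by rewrite subrK.
  near=> h.
  have E : f (h + x) = g (h + x) by near: h.
  have : `|(f \o shift x - (cst (f x) + 'd f x)) h| <= e * `|h| by near: h.
  by rewrite !fctE/= E fgx.
have dgE : 'd g x = 'd f x :> (V -> W) by exact: diff_unique.
split; last by rewrite dgE.
by apply/diff_locallyP; split; rewrite dgE.
Unshelve. all: by end_near. Qed.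

Lemma is_diff_cst_eq0 (c : W) (df : V -> W) (x : V) :
  is_diff x (cst c) df -> forall v, df v = 0.
Proof. by move=> [_ <-] v; rewrite diff_cst. Qed.

End Differential.

Lemma continuous_lincomb4 (R : realType) (W : normedModType R)
  (X : topologicalType) (e1 e2 e3 e4 : W) (a b c d : X -> R) x :
  {for x, continuous a} -> {for x, continuous b} -> {for x, continuous c} ->
  {for x, continuous d} ->
  {for x, continuous (fun y => a y *: e1 + b y *: e2 + c y *: e3 + d y *: e4)}.
Proof.
move=> ha hb hc hd.
have Z (k : X -> R) (e : W) : {for x, continuous k} ->
    {for x, continuous (fun y => k y *: e)} by exact: cvgZr_tmp.
by apply: continuousD; [apply: continuousD; [apply: continuousD|]|]; apply: Z.
Qed.

(** * Differential calculus of quaternion multiplication and inversion *)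

Section Quat.
Context {R : realType}.
Implicit Types q : quat R.

Fact qmul_is_bilinear :
  bilinear_for (GRing.Scale.Law.clone _ _ ( *:%R ) _)
    (GRing.Scale.Law.clone _ _ ( *:%R ) _) (@qmul R).
Proof.
split=> [u|u] a x y /=.
  by rewrite qmulDl; congr (_ + _); rewrite [RHS]quat_scalerAl.
by rewrite qmulDr; congr (_ + _); rewrite [RHS]quat_scalerAr.
Qed.

(* On [qmul] rather than [GRing.mul], whose bilinear instance is already taken
   by the multiplication of the scalar field. *)
HB.instance Definition _ := bilinear_isBilinear.Build R (quat R) (quat R)
  (quat R) _ _ (@qmul R) qmul_is_bilinear.

Lemma qcoord_continuous :
  [/\ continuous (@qre R), continuous (@qi R), continuous (@qj R) &
      continuous (@qk R)].
Proof. by split; exact: coord_continuous. Qed.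

Lemma mkq_sum (a b c d : R) : mkq a b c d =
  a *: mkq 1 0 0 0 + b *: mkq 0 1 0 0 + c *: mkq 0 0 1 0 + d *: mkq 0 0 0 1.
Proof.
by apply: quatP; rewrite !(quatDE, quatZE, mkqE) !mulr0 !mulr1 ?addr0 ?add0r.
Qed.

Lemma continuous_mkq (X : topologicalType) (a b c d : X -> R) x :
  {for x, continuous a} -> {for x, continuous b} -> {for x, continuous c} ->
  {for x, continuous d} ->
  {for x, continuous (fun y => mkq (a y) (b y) (c y) (d y) : quat R)}.
Proof.
move=> ha hb hc hd.
rewrite (_ : (fun y => _) = (fun y => a y *: mkq 1 0 0 0 + b y *: mkq 0 1 0 0 +
  c y *: mkq 0 0 1 0 + d y *: mkq 0 0 0 1)); last first.
  by apply/funext => y; exact: mkq_sum.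
exact: continuous_lincomb4.
Qed.

Lemma qmul_continuous : continuous (fun p : quat R * quat R => p.1 * p.2).
Proof.
have [cr ci cj ck] := qcoord_continuous.
have cM (g h : quat R -> R) : continuous g -> continuous h ->
    continuous (fun x : quat R * quat R => g x.1 * h x.2).
  move=> gc hc x; apply: continuousM.
    exact: continuous_comp (@cvg_fst _ _ _ _ _) (gc _).
  exact: continuous_comp (@cvg_snd _ _ _ _ _) (hc _).
move=> x; apply: (@continuous_mkq (quat R * quat R)%type).
- apply: continuousB; last exact: cM.
  by apply: continuousB; [apply: continuousB|]; apply: cM.
- apply: continuousB; last exact: cM.
  by apply: continuousD; [apply: continuousD|]; apply: cM.
- apply: continuousD; last exact: cM.
  by apply: continuousD; [apply: continuousB|]; apply: cM.
- apply: continuousD; last exact: cM.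
  by apply: continuousB; [apply: continuousD|]; apply: cM.
Qed.

(** Leibniz rule: the chain rule applied to the continuous bilinear product. The order of the
    factors is kept, as quaternions do not commute. *)
Lemma is_diff_qmul {V : normedModType R} (g h dg dh : V -> quat R) z :
  is_diff z g dg -> is_diff z h dh ->
  is_diff z (fun y => g y * h y) (fun v => g z * dh v + dg v * h z).
Proof.
move=> hg hh.
have hm : is_diff (g z, h z) (fun x : quat R * quat R => x.1 * x.2)
    (fun x => g z * x.2 + x.1 * h z).
  pose m : {bilinear quat R -> quat R -> quat R} := @qmul R.
  split; first exact: (@differentiable_bilin _ _ _ _ m _ qmul_continuous).
  exact: (@diff_bilin _ _ _ _ m _ qmul_continuous).
exact: (is_diff_comp (is_diff_pair hg hh) hm).
Qed.

Lemma differentiable_qconj q : differentiable (@qconj R) q.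
Proof.
have [cr ci cj ck] := qcoord_continuous.
have lin : linear (@qconj R).
  by move=> a x y; apply: quatP; rewrite !(mkqE, quatDE, quatZE) ?opprD ?mulrN.
pose L : {linear quat R -> quat R} := HB.pack (@qconj R)
  (GRing.isLinear.Build _ _ _ _ _ lin).
apply: (@linear_differentiable _ _ _ L) => x.
apply: continuous_mkq.
- exact: cr.
- exact: continuousN (ci x).
- exact: continuousN (cj x).
- exact: continuousN (ck x).
Qed.

Lemma differentiable_qdot q : differentiable (fun p : quat R => qdot p p) q.
Proof.
by do ?[apply: differentiableD | apply: differentiableM];
  exact: differentiable_coord.
Qed.

Lemma qinvE q : q != 0 -> q^-1 = (qdot q q)^-1 *: qconj q.
Proof. by move=> q0; rewrite [LHS]/(qinv_total q) /qinv_total ifT. Qed.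

(** Conjugate over squared norm gives differentiability only; the formula comes from differentiating
    the identity [y * y^-1 = 1], valid near [q]. *)
Lemma is_diff_qinv q : q != 0 ->
  is_diff q (fun p => p^-1) (fun v => - (q^-1 * v * q^-1)).
Proof.
move=> q0.
have near0 : \forall p \near q, p != 0.
  exact: (@cvgr_neq0 _ (quat R) _ (nbhs q) _ id q).
have dinv : differentiable (fun p : quat R => p^-1) q.
  have : differentiable
      (* The real factor is written as a multiple of the quaternion 1, so that the Leibniz rule for
         quaternion products applies. *)
      (fun p : quat R => ((qdot p p)^-1 *: (1 : quat R)) * qconj p) q.
    have d1 : differentiable
        (fun p : quat R => (qdot p p)^-1 *: (1 : quat R)) q.
      apply/differentiableZl/differentiableV; first exact: differentiable_qdot.
      by rewrite qdot_eq0.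
    by have [] := is_diff_qmul (differentiableP d1)
      (differentiableP (differentiable_qconj q)).
  move=> /differentiableP d.
  suff /near_eq_is_diff/(_ d)[] : {near q, (fun p : quat R =>
      ((qdot p p)^-1 *: (1 : quat R)) * qconj p) =1 GRing.inv} by [].
  by apply: filterS near0 => p p0; rewrite -scalerAl mul1r -qinvE.
have hm := is_diff_qmul (is_diff_id q) (differentiableP dinv).
have qV1 : {near q, (fun y : quat R => y * y^-1) =1 cst (1 : quat R)}.
  by apply: filterS near0 => p p0; exact: quat_mulrV.
have hv := is_diff_cst_eq0 (near_eq_is_diff qV1 hm).
split=> //; apply/funext => v.
have /eqP := hv v; rewrite addrC addr_eq0 => /eqP E.
by rewrite -mulrA E mulrN opprK mulKr.
Qed.

End Quat.

(** * Closure of the classes [Ck] under sums, products and inverses *)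

Section Ck.
Context {R : realType}.

Section Module.
Context {V : normedModType R}.
Implicit Types (g h : plane R -> V) (U : set (plane R)).

Lemma is_diff_eq_on_open U g h dg z : open U -> U z ->
  (forall y, U y -> g y = h y) -> is_diff z g dg -> is_diff z h dg.
Proof.
move=> oU Uz gh; apply: near_eq_is_diff.
by apply: filterS (open_nbhs_nbhs (conj oU Uz)).
Qed.

(** Openness of [U] makes equality on [U] an equality near each of its points, so it passes to
    differentials. This lets the derivative formulas below, known only on [U], be used in inductions
    on [n]. *)
Lemma eq_Ck n U g h : open U -> (forall z, U z -> g z = h z) ->
  Ck n U g -> Ck n U h.
Proof.
move=> oU; elim: n g h => [|n IH] g h gh /=.
  move=> gc z Uz; have ghz : \forall y \near z, g y = h y.
    by apply: filterS (open_nbhs_nbhs (conj oU Uz)).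
  change (h @ z --> h z); rewrite -gh//; apply: cvg_trans (gc z Uz).
  by apply: near_eq_cvg.
move=> [gd gC]; have hd z : U z -> is_diff z h ('d g z).
  move=> Uz; apply: (is_diff_eq_on_open oU Uz gh).
  exact: differentiableP (gd _ Uz).
split=> [z Uz|v]; first by case: (hd z Uz).
apply: IH (gC v) => z Uz; have [_ dh] := hd z Uz.
exact: esym (congr1 (@^~ v) dh).
Qed.

Lemma Ck_le n U g : Ck n.+1 U g -> Ck n U g.
Proof.
elim: n g => [|n IH] g [gd gC]; last by split=> // v; exact: IH.
by move=> z /gd; exact: differentiable_continuous.
Qed.

Lemma CkD n U g h : open U -> Ck n U g -> Ck n U h ->
  Ck n U (fun z => g z + h z).
Proof.
move=> oU; elim: n g h => [|n IH] g h.
  by move=> gc hc z Uz; exact: continuousD (gc z Uz) (hc z Uz).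
move=> [gd gC] [hd hC]; split=> [z Uz|v].
  exact: differentiableD (gd z Uz) (hd z Uz).
apply: eq_Ck (IH _ _ (gC v) (hC v)) => // z Uz.
exact: esym (congr1 (@^~ v) (diffD (gd z Uz) (hd z Uz))).
Qed.

Lemma CkN n U g : open U -> Ck n U g -> Ck n U (fun z => - g z).
Proof.
move=> oU; elim: n g => [|n IH] g.
  by move=> gc z Uz; exact: continuousN (gc z Uz).
move=> [gd gC]; split=> [z Uz|v]; first exact: differentiableN (gd z Uz).
apply: eq_Ck (IH _ (gC v)) => // z Uz.
exact: esym (congr1 (@^~ v) (diffN (gd z Uz))).
Qed.

End Module.

(** By Leibniz, a directional derivative is a sum of two products in which one factor is
    differentiated; [Ck_le] lowers the other factor to the same order. *)
Lemma Ck_qmul n U (g h : plane R -> quat R) : open U ->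
  Ck n U g -> Ck n U h -> Ck n U (fun z => g z * h z).
Proof.
move=> oU; elim: n g h => [|n IH] g h.
  move=> gc hc z Uz.
  have mc := @qmul_continuous R (g z, h z).
  exact: (@continuous2_cvg _ _ _ _ _ _ _ _ (fun x y : quat R => x * y) _ _
    mc (gc z Uz) (hc z Uz)).
move=> gC hC; have [gd gC'] := gC; have [hd hC'] := hC.
have md z : U z -> is_diff z (fun z => g z * h z)
    (fun v => g z * 'd h z v + 'd g z v * h z).
  move=> Uz; apply: is_diff_qmul; apply: differentiableP.
    exact: gd.
  exact: hd.
split=> [z /md[]//|v].
have gn := Ck_le gC; have hn := Ck_le hC.
apply: (eq_Ck oU _ (CkD oU (IH _ _ gn (hC' v)) (IH _ _ (gC' v) hn))) => z Uz.
have [_ dgh] := md z Uz; exact: esym (congr1 (@^~ v) dgh).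
Qed.

Lemma is_diff_qinv_comp (V : normedModType R) (g dg : V -> quat R) z :
  g z != 0 -> is_diff z g dg ->
  is_diff z (fun y => (g y)^-1) (fun v => - ((g z)^-1 * dg v * (g z)^-1)).
Proof. by move=> gz gd; exact: (is_diff_comp gd (is_diff_qinv gz)). Qed.

(** The derivative of the inverse is built from the inverse itself, of class [n] by induction, and
    the derivative of [g]. *)
Lemma Ck_qinv n U (g : plane R -> quat R) : open U ->
  (forall z, U z -> g z != 0) -> Ck n U g -> Ck n U (fun z => (g z)^-1).
Proof.
move=> oU g0; elim: n => [|n IH].
  move=> gc z Uz; apply: continuous_comp (gc z Uz) _.
  by apply: differentiable_continuous; have [] := is_diff_qinv (g0 z Uz).
move=> gC; have [gd gC'] := gC; have gV := IH (Ck_le gC).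
have dV z (Uz : U z) := is_diff_qinv_comp (g0 z Uz) (differentiableP (gd z Uz)).
split=> [z /dV[]//|v].
apply: (eq_Ck oU _ (CkN oU (Ck_qmul oU (Ck_qmul oU gV (gC' v)) gV))) => z Uz.
have [_ dg] := dV z Uz; exact: esym (congr1 (@^~ v) dg).
Qed.

End Ck.

(** * Quotients and nonvanishing differentials on a Riemann surface *)

Section Surface.
Context {R : realType}.

Lemma open_cimage {M : riemannSurface R} (c : chart R M) :
  atlas M c -> open (cimage c).
Proof. by move=> /atlas_chart[]. Qed.

Lemma cimage_dom {M : riemannSurface R} (c : chart R M) z :
  atlas M c -> cimage c z -> dom c (param c z) /\ Defs.coord c (param c z) = z.
Proof.
by move=> /atlas_chart[_ _ pc _ _] [x xc <-]; rewrite pc.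
Qed.

Lemma smooth_differentiable {V : normedModType R} {M : riemannSurface R}
    (g : M -> V) c z : smooth g -> atlas M c -> cimage c z ->
  differentiable (g \o param c) z.
Proof. by move=> gs ca cz; have [gd _] := gs c ca 1%N; exact: gd. Qed.

Context {M : riemannSurface R}.

Lemma smooth_qdiv (g h : M -> quat R) : smooth g -> smooth h ->
  (forall x, h x != 0) -> smooth (fun x => g x / h x).
Proof.
move=> gs hs h0 c ca n; have oU := open_cimage ca.
exact: Ck_qmul oU (gs c ca n) (Ck_qinv oU (fun z _ => h0 _) (hs c ca n)).
Qed.

(** Quotient rule with the inverse of [h] factored out on the right; the quotient itself then
    multiplies the differential of [h] from the left. *)
Lemma dform_qdiv (g h : M -> quat R) c z v : smooth g -> smooth h ->
  (forall x, h x != 0) -> atlas M c -> cimage c z ->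
  dform (fun x => g x / h x) c z v =
    (dform g c z v - g (param c z) / h (param c z) * dform h c z v) /
    h (param c z).
Proof.
move=> gs hs h0 ca cz.
have dg := differentiableP (smooth_differentiable gs ca cz).
have dh := differentiableP (smooth_differentiable hs ca cz).
have [_ E] := is_diff_qmul dg (is_diff_qinv_comp (h0 (param c z)) dh).
apply: etrans (congr1 (@^~ v) E) _.
by rewrite /= mulrN addrC mulrBl !mulrA.
Qed.

(** Any point [x] may be a branch point, but nearby points other than [x] are not, and the open
    image of a chart supplies such points. *)
Lemma branched_conformal_immersion_dform_neq0 (g : M -> quat R) :
  branched_conformal_immersion g ->
  exists c z v, [/\ atlas M c, cimage c z & dform g c z v != 0].
Proof.
move=> [_ gb]; have [x _] := surface_nonempty M.
have [c ca xc] := atlas_cover x; have [_ oU pc _ pcont] := atlas_chart ca.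
set z0 := Defs.coord c x; have Uz0 : cimage c z0 by exists x.
have pz0 : param c z0 = x by exact: pc.
have pcz : {for z0, continuous (param c)}.
  have := pcont; rewrite continuous_open_subspace// => /(_ z0); apply.
  by rewrite inE.
(* A line through [z0]: for small nonzero [t] it stays in the chart image and avoids [z0]. *)
pose l (t : R) : plane R := z0 + t *: (1, 0).
have l0 : l 0 = z0 by rewrite /l scale0r addr0.
have lc : l t @[t --> 0^'] --> z0.
  have lcont : {for 0, continuous l}.
    by apply: continuousD; [exact: cvg_cst | exact: scalel_continuous].
  by rewrite -l0; exact: cvg_trans (cvg_app l (cvg_within _)) lcont.
have nU : nbhs z0 (cimage c) by exact: open_nbhs_nbhs.
have nA : \forall z \near z0, param c z != x ->
    conformal_immersion_at g (param c z).
  have := gb x; rewrite /prop_near1 /dnbhs /within -pz0 => /pcz.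
  exact.
have nlt : \forall t \near (0 : R)^', cimage c (l t) /\
    (param c (l t) != x -> conformal_immersion_at g (param c (l t))).
  exact: lc _ (filterI nU nA).
have nt : \forall t \near (0 : R)^', t != 0 by exact: nbhs_dnbhs_neq.
near ((0 : R)^') => t.
have [Ut At] : cimage c (l t) /\
    (param c (l t) != x -> conformal_immersion_at g (param c (l t))).
  by near: t.
have t0 : t != 0 by near: t.
have [dt ct] := cimage_dom ca Ut.
have ptx : param c (l t) != x.
  (* Equality of the points would give equal coordinates [z0 = l t], whose first component forces
     [t = 0]. *)
  apply/eqP => E; move: ct; rewrite E -/z0 -[LHS]addr0 => /addrI.
  by move=> /(congr1 fst)/=; rewrite scaler1 => /esym/eqP; rewrite (negbTE t0).
have [_ _ gx] := At ptx c ca dt; rewrite ct in gx.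
by exists c, (l t), (1, 0).
Unshelve. all: by end_near. Qed.

End Surface.

(** * The Riccati equation of a parallel section and the characterization of real parameters *)

Section Darboux.
Context {R : realType} {M Mt : riemannSurface R} {pr : Mt -> M}.

(** Both parallel equations are substituted into the quotient rule. The first contributes the term
    in the differential of [f]; in the second, [alpha] is [T] times [beta], which produces the
    conjugate of [rho]. *)
Lemma dform_parallel_quotient (f : M -> quat R) fd rho
    (alpha beta : Mt -> quat R) c z v
    (T := alpha (param c z) / beta (param c z)) :
  parallel_section pr f fd rho alpha beta ->
  (forall x, beta x != 0) -> atlas Mt c -> cimage c z ->
  dform (fun x => alpha x / beta x) c z v = - dform (f \o pr) c z v +
    T * dform fd c z v * T * (beta (param c z) * rho / beta (param c z)).
Proof.
move=> [as_ bs ab] b0 ca cz; have [da db] := ab c ca z cz v.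
have bu : beta (param c z) \is a GRing.unit by exact: b0.
rewrite dform_qdiv// da db mulrBl mulrK//; congr (_ + _).
by rewrite !(mulNr, mulrN) opprK -/T !mulrA (divrK bu).
Qed.

End Darboux.

Theorem corollary3p9 (R : realType) (M Mt : riemannSurface R) (pr : Mt -> M)
  (hpr : universal_cover pr)
  (f : M -> quat R) (f_im : forall x, im_quat (f x))
  (f_iso : isothermic pr f) (f_sphere : ~ in_round_sphere f)
  (fd : Mt -> quat R) (f_dual : dual_surface pr f fd)
  (rho : quat R) (rho_cplx : complex_line rho) (rho_neq0 : rho != 0)
  (alpha beta fhat : Mt -> quat R)
  (fhat_darboux : rho_darboux_transform pr f fd rho alpha beta fhat) :
  classical_darboux_transform pr f fd fhat <->
  exists2 r : R, r != 0 & rho = r%:A.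
Proof.
have [par b0 T0 fhatE] := fhat_darboux; have [as_ bs _] := par.
have bu x : beta x \is a GRing.unit by exact: b0.
split=> [[T [r [_ r0 _ dT TE]]] | [r r0 rhoE]].
  (* Both sides are the difference of [fhat] and the lift of [f]. *)
  have {TE}TE : T = fun x => alpha x / beta x.
    by apply/funext => x; apply: (@addrI _ (f (pr x))); rewrite -TE -fhatE.
  have [c [z [v [ca cz fd0]]]] :=
    branched_conformal_immersion_dform_neq0 f_dual.1.
  (* Equating the two expressions for the differential of [T] cancels the term in [f]. *)
  exists r => //; have := dT c ca z cz v.
  rewrite {1}TE (dform_parallel_quotient _ par)// => /addrI.
  set p := param c z; have <- : T p = alpha p / beta p by rewrite TE.
  have Tu : T p \is a GRing.unit by rewrite TE; exact: T0.
  have fu : dform fd c z v \is a GRing.unit by exact: fd0.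
  (* The real [r] is central and moves to the far right, so both sides begin with [T dfd T], an
     invertible factor at the chosen point and direction. *)
  rewrite -[RHS]mulrA mulr_algl -mulr_algr [RHS]mulrA => /mulrI E.
  have {}E : beta p * rho / beta p = r%:A by apply: E; rewrite !unitrMl.
  by apply: (mulrI (bu p)); rewrite mulr_algr -mulr_algl -E divrK.
(* Conversely, a real [rho] equals its conjugate by [beta], so the same quotient solves the
   classical equation with parameter [r]. *)
exists (fun x => alpha x / beta x), r; split=> //.
  exact: smooth_qdiv.
move=> c ca z cz v; rewrite (dform_parallel_quotient _ par)// rhoE.
rewrite mulr_algr -scalerAl divrr// [in RHS]mulr_algr mulr_algr.
by rewrite scalerAl.
Qed.
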